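(* Let $V$ and $\widetilde V$ be finite-dimensional real inner product spaces, let $A\colon V\to V$ be symmetric positive semidefinite with $A\neq 0$, let $f\in\mathcal R(A)$, let $\Pi\colon\widetilde V\to V$ be a surjective linear operator, let $\widetilde B\colon\widetilde V\to\widetilde V$ be a linear operator, and set $\widetilde A=\Pi^tA\Pi$ and $B=\Pi\widetilde B\Pi^t$. If the symmetrized operator $\widetilde{\bar B}=\widetilde B+\widetilde B^t-\widetilde B^t\widetilde A\widetilde B\colon\widetilde V\to\widetilde V$ is SPD, then the iterative method $u^{m+1}=u^m+B(f-Au^m)$, $m\ge 0$, for solving $Au=f$ converges, and $$|I-BA|_A^2=1-\left(\sup_{v\in\mathcal R(A),\ |v|_A=1}\ \inf_{\phi\in\mathcal N(A)}\ \inf_{\tilde v\in\widetilde V,\ \Pi\tilde v=v+\phi}(\widetilde{\bar B}^{-1}\tilde v,\tilde v)\right)^{-1}.$$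
   Context: All inner products are denoted $(\cdot,\cdot)$; $T^t$ is the adjoint, $\mathcal N(T)$ the null space, $\mathcal R(T)$ the range of a linear operator $T$. A symmetric operator $T$ is SPD if $(Tv,v)>0$ for all $v\ne0$, and symmetric positive semidefinite (semi-SPD) if $(Tv,v)\ge 0$ for all $v$. For semi-SPD $T$, $|v|_T=(Tv,v)^{1/2}$, and for a linear operator $S$, $|S|_T=\sup_{|v|_T=1}|Sv|_T$. Convergence of an iterative method $\{u^m\}$ for the semi-SPD system $Au=f$ means: $Qu^m\to Qu$ for every initial guess $u^0\in V$, where $Q$ is the orthogonal projection of $V$ onto $\mathcal R(A)$ and $u$ is any solution of $Au=f$ ($Qu$ does not depend on the choice of $u$). *)

(* Defs.v *)
(* A finite-dimensional real inner product space
   is a [V : vectType R], [R : realType], together with an inner product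
   [ip : {dot V for idfun}]; operators are elements of ['Hom(U, V)]. *)
From HB Require Import structures.
From mathcomp Require Import all_boot all_order all_algebra.
From mathcomp Require Import all_classical all_reals all_analysis.

Set Implicit Arguments.
Unset Strict Implicit.
Unset Printing Implicit Defensive.

Import Order.TTheory GRing.Theory Num.Theory.
Import numFieldNormedType.Exports.

Local Open Scope classical_set_scope.
Local Open Scope ring_scope.

Section Operators.
Context {R : realType} {U V : vectType R}.
Variables (ipU : {dot U for idfun}) (ipV : {dot V for idfun}).

(* The value [0] is never used: see [adjointP] and [adjoint_unique]. *)
Definition adjoint (T : 'Hom(U, V)) : 'Hom(V, U) :=
  xget 0 [set S : 'Hom(V, U) | forall u v, ipV (T u) v = ipU u (S v)].

End Operators.

Section SelfOperators.
Context {R : realType} {V : vectType R}.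
Variable ip : {dot V for idfun}.
Implicit Types (T S A B : 'End(V)) (v f : V).

Definition symmetric_op T := forall u v, ip (T u) v = ip u (T v).

Definition SPD T := symmetric_op T /\ forall v, v != 0 -> 0 < ip (T v) v.

Definition semiSPD T := symmetric_op T /\ forall v, 0 <= ip (T v) v.

Definition ipnorm v : R := Num.sqrt (ip v v).

Definition seminorm T v : R := Num.sqrt (ip (T v) v).

(* Extended-real valued: for a merely semidefinite [T] the supremum is
   infinite for some [S]. *)
Definition opseminorm T S : \bar R :=
  ereal_sup [set (seminorm T (S v))%:E | v in [set v | seminorm T v = 1]].

(* [daddv_pi X Y] is the projection onto [X] along [Y]. *)
Definition orthproj (X : {vspace V}) : 'End(V) := daddv_pi X (orthov ip X).

Definition iterates A B f (u0 : V) (m : nat) : V :=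
  iter m (fun u => u + B (f - A u)) u0.

(* [um u0] is the sequence produced by the method from the initial guess [u0]. *)
Definition method_converges A f (um : V -> nat -> V) : Prop :=
  let Q := orthproj (limg A) in
  forall u0 u : V, A u = f ->
    (fun m => ipnorm (Q (um u0 m) - Q u)) @ \oo --> (0 : R).

End SelfOperators.

Section Adequacy.
Context {R : realType}.

Lemma dot_eq0 {V : vectType R} (ip : {dot V for idfun}) (v : V) :
  ip v v = 0 -> v = 0.
Proof.
move=> v0; apply/eqP; apply: contraT => /(neq0_dnorm_gt0 (s := ip)).
by rewrite v0 ltxx.
Qed.

Lemma dot_eql {V : vectType R} (ip : {dot V for idfun}) (v w : V) :
  (forall u, ip u v = ip u w) -> v = w.
Proof.
move=> h; apply/eqP; rewrite -subr_eq0; apply/eqP/(dot_eq0 (ip := ip)).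
by rewrite linearBr /= h subrr.
Qed.

Lemma orthproj_decomp {V : vectType R} (ip : {dot V for idfun})
    (X : {vspace V}) : (X :&: orthov ip X = 0)%VS /\ (X + orthov ip X = fullv)%VS.
Proof.
have disj : (X :&: orthov ip X = 0)%VS.
  apply/eqP; rewrite -subv0; apply/subvP => v; rewrite memv_cap memv0.
  by case/andP => vX /mem_orthovP/(_ _ vX)/dot_eq0 ->.
split=> //; apply/eqP; rewrite eqEsubv subvf /=; apply/subvP => v _.
pose F (w : V) : 'rV[R]_(\dim X) := \row_i ip w (vbasis X)`_i.
have Flin : linear F.
  by move=> a x y; apply/rowP => i; rewrite !mxE linearPl.
pose FL := GRing.isLinear.Build _ _ _ _ F Flin.
pose Fl : {linear V -> 'rV[R]_(\dim X)} := HB.pack F FL.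
pose L := linfun Fl.
have L0 w : L w = 0 -> w \in orthov ip X.
  move=> Lw; apply/mem_orthovP => x /coord_vbasis ->.
  rewrite linear_sumr big1 // => i _; rewrite linearZr /=.
  by move/rowP/(_ i): Lw; rewrite lfunE /= !mxE => ->; rewrite mulr0.
have dimL : (\dim (L @: X) = \dim X)%VS.
  apply: limg_dim_eq; apply/eqP; rewrite -subv0 -disj; apply/subvP => w.
  rewrite !memv_cap => /andP[-> /=]; rewrite memv_ker => /eqP; exact: L0.
have surj : (L @: X = fullv)%VS.
  by apply/eqP; rewrite eqEdim subvf dimL dimvf /dim /= mul1n.
have /memv_imgP[x xX Lx] : L v \in (L @: X)%VS by rewrite surj memvf.
rewrite -(subrK x v) addrC memv_add //; apply: L0.
by rewrite linearB /= Lx subrr.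
Qed.

Lemma orthproj_mem {V : vectType R} (ip : {dot V for idfun})
    (X : {vspace V}) (v : V) : orthproj ip X v \in X.
Proof. exact: memv_pi. Qed.

Lemma orthproj_orth {V : vectType R} (ip : {dot V for idfun})
    (X : {vspace V}) (v x : V) : x \in X -> ip (v - orthproj ip X v) x = 0.
Proof.
have [disj full] := orthproj_decomp ip X.
move=> xX; have := daddv_pi_add (w := v) disj.
rewrite full memvf => /(_ isT) e.
have -> : v - orthproj ip X v = daddv_pi (orthov ip X) X v.
  by apply/eqP; rewrite subr_eq addrC /orthproj e.
by have /mem_orthovP := memv_pi (orthov ip X) X v; apply.
Qed.

Lemma riesz {V : vectType R} (ip : {dot V for idfun}) (l : 'Hom(V, R^o)) :
  exists w, forall u, l u = ip u w.
Proof.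
have [disj full] := orthproj_decomp ip (lker l).
case: (pselect (exists2 w, w \in orthov ip (lker l) & w != 0)); last first.
  move=> h; exists 0 => u; rewrite linear0r; apply/eqP; rewrite -memv_ker.
  suff <- : (lker l + orthov ip (lker l) = lker l)%VS by rewrite full memvf.
  apply/addv_idPl/subvP => w wo; case: (eqVneq w 0) => [->|w0].
    exact: mem0v.
  by case: h; exists w.
case=> w wo w0; have ww : ip w w != 0 by rewrite gt_eqF// (neq0_dnorm_gt0 (s := ip)).
have lw : l w != 0.
  apply: contra_neq w0 => lw; apply/eqP; rewrite -memv0 -disj memv_cap wo.
  by rewrite memv_ker lw eqxx.
exists ((l w / ip w w) *: w) => u; rewrite linearZr /=.
have : l w *: u - (l u : R) *: w \in lker l.
  rewrite memv_ker linearB !linearZ /= scalerN subr_eq0.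
  by apply/eqP; exact: (mulrC (l w : R) (l u : R)).
move/mem_orthovP: wo => /[apply]; rewrite linearBr !linearZr /=.
move/eqP; rewrite subr_eq0 => /eqP e.
have -> : ip u w = ip w u.
  by have /= := hermC ip u w; rewrite expr0 mul1r.
by rewrite mulrAC e mulfK.
Qed.

Lemma adjointP {U V : vectType R} (ipU : {dot U for idfun})
    (ipV : {dot V for idfun}) (T : 'Hom(U, V)) (u : U) (v : V) :
  ipV (T u) v = ipU u (adjoint ipU ipV T v).
Proof.
suff [S hS] : exists S : 'Hom(V, U), forall u v, ipV (T u) v = ipU u (S v).
  rewrite /adjoint; have := @xgetPex _ 0
    [set S : 'Hom(V, U) | forall u v, ipV (T u) v = ipU u (S v)].
  by apply; exists S.
have /choice[s hs] : forall v, exists w, forall u, ipV (T u) v = ipU u w.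
  move=> {u} {}v.
  pose F (u : U) : R^o := ipV (T u) v.
  have Flin : linear F by move=> a x y; rewrite /F linearP linearPl.
  pose FL := GRing.isLinear.Build _ _ _ _ F Flin.
  pose Fl : {linear U -> R^o} := HB.pack F FL.
  have [w hw] := riesz ipU (linfun Fl).
  by exists w => u; rewrite -hw lfunE.
have slin : linear s.
  move=> a x y; apply: (dot_eql (ip := ipU)) => w.
  by rewrite -hs !linearPr /= !hs.
pose SL := GRing.isLinear.Build _ _ _ _ s slin.
pose Sl : {linear V -> U} := HB.pack s SL.
by exists (linfun Sl) => x y; rewrite lfunE /= hs.
Qed.

Lemma adjoint_unique {U V : vectType R} (ipU : {dot U for idfun})
    (ipV : {dot V for idfun}) (T : 'Hom(U, V)) (S : 'Hom(V, U)) :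
  (forall u v, ipV (T u) v = ipU u (S v)) -> S = adjoint ipU ipV T.
Proof.
move=> h; apply/lfunP => v; apply: (dot_eql (ip := ipU)) => u.
by rewrite -h (adjointP ipU ipV).
Qed.

End Adequacy.

(* Main.v *)
(** Write M = Pi Bbar Pi^t, an SPD operator on V. Expanding the square gives
    |(I - BA)v|_A^2 = |v|_A^2 - (M A v, A v), so |I - BA|_A^2 = 1 - K where K is
    the infimum of (M A v, A v) over |v|_A = 1. Coercivity of M on the range of
    A makes K positive, which yields convergence. The supremum on the
    right-hand side is 1/K: solving A M A u = A v gives the decomposition
    w = Bbar Pi^t A u of cost at most 1/K, while Cauchy-Schwarz for Bbar bounds
    the cost of any decomposition of the range part of u from below by
    1/(M A u, A u). *)
Require Import Defs.
From HB Require Import structures.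
From mathcomp Require Import all_boot all_order all_algebra.
From mathcomp Require Import ring lra.
From mathcomp Require Import all_classical all_reals all_analysis.
Import Order.TTheory GRing.Theory Num.Theory.
Import numFieldNormedType.Exports.
Local Open Scope classical_set_scope.
Local Open Scope ring_scope.

Set Implicit Arguments.
Unset Strict Implicit.
Unset Printing Implicit Defensive.

(** * Semidefinite forms on one inner product space *)

Lemma lfun_scaler (R : realType) (U V : vectType R) (T : 'Hom(U, V)) (a : R) u :
  T (a *: u) = a *: T u.
Proof. exact: linearZ. Qed.

Section InnerProduct.
Variables (R : realType) (V : vectType R) (ip : {dot V for idfun}).
Implicit Types (T S A M : 'End(V)) (u v w : V).

Lemma dotC u v : ip u v = ip v u.
Proof. by have /= := hermC ip u v; rewrite expr0 mul1r. Qed.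

Lemma dotZl (a : R) u v : ip (a *: u) v = a * ip u v.
Proof. exact: linearZl_LR. Qed.

Lemma dotZr (a : R) u v : ip u (a *: v) = a * ip u v.
Proof. by rewrite dotC dotZl dotC. Qed.

Lemma dot_sum (I : finType) (a b : I -> R) (x y : I -> V) :
  ip (\sum_i a i *: x i) (\sum_j b j *: y j) =
  \sum_i \sum_j a i * (b j * ip (x i) (y j)).
Proof.
have suml z (h : I -> V) : ip (\sum_i h i) z = \sum_i ip (h i) z.
  exact: linear_sumlz.
rewrite suml; apply: eq_bigr => i _; rewrite dotC suml.
by apply: eq_bigr => j _; rewrite dotC dotZl dotZr.
Qed.

Lemma dot_ge0 v : 0 <= ip v v.
Proof.
case: (eqVneq v 0) => [->|v0]; first by rewrite linear0r.
exact/ltW/neq0_dnorm_gt0.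
Qed.

Lemma SPD_semiSPD T : SPD ip T -> semiSPD ip T.
Proof.
case=> Tsym Tpos; split=> // v.
case: (eqVneq v 0) => [->|/Tpos/ltW//]; by rewrite linear0r.
Qed.

(** The quadratic [t -> (T(u + tv), u + tv)] is nonnegative; it is evaluated at its minimiser
    [-b / c], or, when [c = 0], it is affine and forces [b = 0]. *)
Lemma semiSPD_CauchySchwarz T u v : semiSPD ip T ->
  ip (T u) v ^+ 2 <= ip (T u) u * ip (T v) v.
Proof.
case=> Tsym Tge0; set a := ip (T u) u; set b := ip (T u) v; set c := ip (T v) v.
have quad t : 0 <= a + 2 * t * b + t ^+ 2 * c.
  have := Tge0 (u + t *: v).
  have -> : T (u + t *: v) = T u + t *: T v by rewrite linearD linearZ.
  rewrite linearDl /= !linearDr /= !dotZl !dotZr.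
  have -> : ip (T v) u = b by rewrite Tsym dotC.
  rewrite -/a -/b -/c; lra.
have := Tge0 v; rewrite -/c le_eqVlt => /orP[/eqP c0|c_gt0].
  rewrite -c0 mulr0; case: (eqVneq b 0) => [->|b0]; first by rewrite expr0n.
  (* This [t] is chosen so that the affine function takes the value -1. *)
  have := quad (- (a + 1) / (2 * b)); rewrite -c0 mulr0 addr0.
  have -> : a + 2 * (- (a + 1) / (2 * b)) * b = -1 by field.
  by move=> ?; lra.
have := quad (- b / c).
have -> : a + 2 * (- b / c) * b + (- b / c) ^+ 2 * c = (a * c - b ^+ 2) / c.
  by field; rewrite gt_eqF.
by rewrite pmulr_lge0 ?invr_gt0// subr_ge0.
Qed.

Lemma seminorm_sqr T v : semiSPD ip T -> seminorm ip T v ^+ 2 = ip (T v) v.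
Proof. by case=> _ Tge0; rewrite sqr_sqrtr. Qed.

(** Cauchy-Schwarz for the pair [v], [T v] bounds [(Tv, Tv)^2] by a multiple of [(Tv, v)]. *)
Lemma semiSPD_ker T v : semiSPD ip T -> ip (T v) v = 0 -> T v = 0.
Proof.
move=> Tsemi Tv0; apply: (dot_eq0 (ip := ip)); apply/eqP.
rewrite -sqrf_eq0 eq_le sqr_ge0 andbT.
by rewrite (le_trans (semiSPD_CauchySchwarz v (T v) Tsemi))// Tv0 mul0r.
Qed.

Lemma SPD_lker0 T : SPD ip T -> lker T == 0%VS.
Proof.
case=> _ Tpos; rewrite -subv0; apply/subvP => v; rewrite memv_ker memv0 => /eqP Tv0.
by apply: contraT => /Tpos; rewrite Tv0 linear0l ltxx.
Qed.

Lemma symmetric_limg_lker_orth T u v : symmetric_op ip T ->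
  u \in limg T -> v \in lker T -> ip u v = 0.
Proof.
move=> Tsym /memv_imgP[x _ ->]; rewrite memv_ker => /eqP Tv0.
by rewrite Tsym Tv0 linear0r.
Qed.

Lemma symmetric_orthproj_limg T v : symmetric_op ip T ->
  T (orthproj ip (limg T) v) = T v.
Proof.
move=> Tsym; apply/esym/eqP; rewrite -subr_eq0 -linearB; apply/eqP.
apply: (dot_eql (ip := ip)) => u.
by rewrite linear0r -Tsym dotC orthproj_orth// memv_img ?memvf.
Qed.

(** The projection of [v] lies both in the range and in the kernel of [T], so it is orthogonal to
    itself. *)
Lemma symmetric_orthproj_lker T v : symmetric_op ip T ->
  T v = 0 -> orthproj ip (limg T) v = 0.
Proof.
move=> Tsym Tv0; apply: (dot_eq0 (ip := ip)).
apply: (symmetric_limg_lker_orth Tsym); first exact: orthproj_mem.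
by rewrite memv_ker symmetric_orthproj_limg// Tv0.
Qed.

(** The [c i] are the Riesz vectors of the coordinate functionals; coordinates thus become inner
    products, to which Cauchy-Schwarz applies. *)
Lemma dual_family : exists c : 'I_(\dim {:V}) -> V,
  forall v, v = \sum_i ip v (c i) *: (vbasis {:V})`_i.
Proof.
have /choice[c hc] : forall i : 'I_(\dim {:V}),
    exists w, forall v, coord (vbasis {:V}) i v = ip v w.
  move=> i; pose F (v : V) : R^o := coord (vbasis {:V}) i v.
  have Flin : linear F by move=> a x y; rewrite /F linearP.
  pose FL := GRing.isLinear.Build _ _ _ _ F Flin.
  pose Fl : {linear V -> R^o} := HB.pack F FL.
  by have [w hw] := riesz ip (linfun Fl); exists w => v; rewrite -hw lfunE.
exists c => v; rewrite {1}(coord_vbasis (memvf v)).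
by apply: eq_bigr => i _; rewrite hc.
Qed.

(* The coordinates of [M w] are [ip (M w) (c i)] for fixed vectors [c i], hence
   of size O(|w|_M) by Cauchy-Schwarz; this replaces a compactness argument. *)
Lemma semiSPD_dominates M S T : semiSPD ip M -> exists2 C : R, 0 < C &
  forall w, ip (S (M w)) (T (M w)) <= C * ip (M w) w.
Proof.
move=> Msemi; have [c hc] := dual_family.
pose k i := seminorm ip M (c i).
pose D := \sum_i \sum_j k i * k j *
  `|ip (S (vbasis {:V})`_i) (T (vbasis {:V})`_j)|.
have k0 i : 0 <= k i by exact: sqrtr_ge0.
have D0 : 0 <= D.
  by apply: sumr_ge0 => i _; apply: sumr_ge0 => j _; rewrite !mulr_ge0.
exists (D + 1) => [|w]; first by rewrite ltr_wpDl.
have coord_le i : `|ip (M w) (c i)| <= seminorm ip M w * k i.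
  rewrite -(ler_pXn2r (n := 2))// ?nnegrE ?mulr_ge0 ?sqrtr_ge0//.
  by rewrite real_normK ?num_real// exprMn !seminorm_sqr// semiSPD_CauchySchwarz.
apply: (@le_trans _ _ (D * ip (M w) w)); last first.
  by rewrite ler_wpM2r ?lerDl//; apply Msemi.
have expand (L : 'End(V)) :
    L (M w) = \sum_i ip (M w) (c i) *: L (vbasis {:V})`_i.
  by rewrite {1}(hc (M w)) linear_sum; apply: eq_bigr => i _; rewrite linearZ.
rewrite !expand dot_sum mulr_suml; apply: ler_sum => i _; rewrite mulr_suml.
apply: ler_sum => j _.
rewrite mulrA (le_trans (ler_norm _))// !normrM.
rewrite -seminorm_sqr// [leRHS]mulrAC ler_wpM2r//.
have -> : k i * k j * seminorm ip M w ^+ 2 =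
  (seminorm ip M w * k i) * (seminorm ip M w * k j) by ring.
by rewrite ler_pM.
Qed.

End InnerProduct.

Lemma adjoint_dot (R : realType) (U V : vectType R) (ipU : {dot U for idfun})
    (ipV : {dot V for idfun}) (T : 'Hom(U, V)) u v :
  ipU (adjoint ipU ipV T v) u = ipV v (T u).
Proof. by rewrite dotC -adjointP dotC. Qed.

(** * The energy seminorm of [A] and the range of [A] *)

Section SemiSPD.
Variables (R : realType) (V : vectType R) (ip : {dot V for idfun}) (A : 'End(V)).
Hypothesis Asemi : semiSPD ip A.
Implicit Types (M E T : 'End(V)) (u v w : V).

Let Asym : symmetric_op ip A := proj1 Asemi.

Lemma limg_pinvK v : A (A^-1%VF (A v)) = A v.
Proof. by rewrite limg_lfunVK// memv_img ?memvf. Qed.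

Lemma seminorm_eq1 v : seminorm ip A v = 1 <-> ip (A v) v = 1.
Proof.
split=> [v1|v1]; first by rewrite -seminorm_sqr// v1 expr1n.
by rewrite /seminorm v1 sqrtr1.
Qed.

Lemma form_scale T (a : R) v : ip (T (a *: v)) (a *: v) = a ^+ 2 * ip (T v) v.
Proof. by rewrite lfun_scaler dotZl dotZr mulrA. Qed.

Lemma seminorm_normalize v : A v != 0 ->
  exists2 c : R, 0 < c & seminorm ip A (c^-1 *: v) = 1 /\ c ^+ 2 = ip (A v) v.
Proof.
move=> Av0; have Avv : 0 < ip (A v) v.
  rewrite lt_neqAle (proj2 Asemi) andbT eq_sym.
  by apply: contra_neq Av0 => /semiSPD_ker ->.
exists (Num.sqrt (ip (A v) v)); first by rewrite sqrtr_gt0.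
split; last by rewrite sqr_sqrtr ?ltW.
by apply/seminorm_eq1; rewrite form_scale exprVn sqr_sqrtr ?ltW// mulVf ?gt_eqF.
Qed.

(** The domination bound at [w = A v] with [S = M^-1] and [T = A^-1 M^-1] has left side [(Av, A^-1 A
    v) = (v, A A^-1 A v) = (v, Av)], where [A^-1] is only a generalized inverse. *)
Lemma semiSPD_coercive M : SPD ip M -> exists2 d : R, 0 < d &
  forall v, d * ip (A v) v <= ip (M (A v)) (A v).
Proof.
move=> MSPD.
have [C C0 hC] := semiSPD_dominates M^-1%VF (A^-1 \o M^-1)%VF (SPD_semiSPD MSPD).
exists C^-1 => [|v]; first by rewrite invr_gt0.
rewrite ler_pdivrMl//; have := hC (A v).
by rewrite comp_lfunE lker0_lfunK ?(SPD_lker0 MSPD)// Asym limg_pinvK dotC.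
Qed.

(** This turns decay of the energy into norm convergence of the projected error. The operator [L]
    maps [A v] to the projection of [v], since [v] and [A^-1 (A v)] differ by a kernel vector. *)
Lemma orthproj_bound : exists2 C : R, 0 < C &
  forall v, ipnorm ip (orthproj ip (limg A) v) ^+ 2 <= C * ip (A v) v.
Proof.
pose L := (orthproj ip (limg A) \o A^-1)%VF.
have [C C0 hC] := semiSPD_dominates L L Asemi; exists C => // v.
rewrite sqr_sqrtr ?dot_ge0//; have := hC v.
suff -> : L (A v) = orthproj ip (limg A) v by [].
apply/eqP; rewrite -subr_eq0 comp_lfunE -linearB; apply/eqP.
by apply: symmetric_orthproj_lker => //; rewrite linearB /= limg_pinvK subrr.
Qed.

(** From [(AMAu, u) = (MAu, Au)] and definiteness of [M], the kernel of [AMA] lies in that of [A];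
    rank-nullity then compares the ranges. This makes [AMAu = Av] solvable. *)
Lemma limg_congr M : SPD ip M -> limg (A \o M \o A)%VF = limg A.
Proof.
move=> [Msym Mpos]; apply/eqP; rewrite eqEdim; apply/andP; split.
  by apply/subvP => _ /memv_imgP[u _ ->]; rewrite !comp_lfunE memv_img ?memvf.
suff kerE : (lker (A \o M \o A) <= lker A)%VS.
  have := limg_ker_dim (A \o M \o A)%VF fullv; have := limg_ker_dim A fullv.
  rewrite !capfv => <- dimE; have := dimvS kerE.
  by rewrite -(leq_add2r (\dim (limg (A \o M \o A)))) dimE leq_add2l.
apply/subvP => u; rewrite !memv_ker !comp_lfunE => /eqP AMAu.
by apply: contraT => /Mpos; rewrite -Asym AMAu linear0l ltxx.
Qed.

(** * Contraction factor and convergence from an energy identity *)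

Section Contraction.
Variables (E : 'End(V)) (q : V -> R) (u0 : V).
Hypothesis energy : forall v, ip (A (E v)) (E v) = ip (A v) v - q v.
Hypothesis u01 : seminorm ip A u0 = 1.

(** The two hypotheses make [K] the infimum of [q] on the unit sphere, and the energy identity gives
    [|Ev|_A = sqrt(1 - q v)] there. *)
Lemma sqr_opseminorm (K : R) :
  (forall v, seminorm ip A v = 1 -> K <= q v) ->
  (forall k, (forall v, seminorm ip A v = 1 -> k <= q v) -> k <= K) ->
  (opseminorm ip A E ^+ 2 = (1 - K)%:E)%E.
Proof.
move=> lbK glbK.
have semE v : seminorm ip A v = 1 -> seminorm ip A (E v) = Num.sqrt (1 - q v).
  by move=> /seminorm_eq1 v1; rewrite /seminorm energy v1.
have q_le1 v : seminorm ip A v = 1 -> q v <= 1.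
  by move=> /seminorm_eq1 v1; rewrite -subr_ge0 -v1 -energy; apply Asemi.
have K1 : 0 <= 1 - K by rewrite subr_ge0 (le_trans (lbK _ u01))// q_le1.
suff -> : opseminorm ip A E = (Num.sqrt (1 - K))%:E.
  by rewrite -EFin_expe sqr_sqrtr.
apply/eqP; rewrite eq_le; apply/andP; split.
  apply: ge_ereal_sup => _ [v /= v1 <-]; rewrite lee_fin semE//.
  by rewrite ler_sqrt// lerD2l lerN2 lbK.
have : forall v, seminorm ip A v = 1 ->
    ((Num.sqrt (1 - q v))%:E <= opseminorm ip A E)%E.
  by move=> v v1; rewrite -semE//; apply: ereal_sup_ubound; exists v.
(* The value +oo is a trivial upper bound; the unit vector [u0] excludes -oo. *)
case: (opseminorm ip A E) => [y| |] y_ge; last 2 first.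
- by rewrite leey.
- by have := y_ge _ u01.
have y0 : 0 <= y by rewrite -lee_fin (le_trans _ (y_ge _ u01))// lee_fin sqrtr_ge0.
rewrite lee_fin -(ler_pXn2r (n := 2))// ?nnegrE ?sqrtr_ge0// sqr_sqrtr//.
(* It remains to see that [1 - y^2] is a lower bound of [q] on the unit sphere. *)
rewrite lerBlDr -lerBlDl; apply: glbK => v v1.
rewrite lerBlDl -lerBlDr -[1 - q v]sqr_sqrtr ?subr_ge0 ?q_le1//.
by rewrite ler_pXn2r ?nnegrE ?sqrtr_ge0// -lee_fin y_ge.
Qed.

(** Each application of [E] shrinks the energy by the factor [1 - d], which the unit vector [u0]
    shows to be nonnegative. *)
Lemma iterates_seminorm_cvg (d : R) : 0 < d ->
  (forall v, d * ip (A v) v <= q v) ->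
  forall e, (fun m => ip (A (iter m E e)) (iter m E e)) @ \oo --> (0 : R).
Proof.
move=> d0 q_ge e.
have contr v : ip (A (E v)) (E v) <= (1 - d) * ip (A v) v.
  by rewrite energy mulrBl mul1r lerD2l lerN2.
have d1 : 0 <= 1 - d.
  have := contr u0; rewrite (seminorm_eq1 u0).1// mulr1.
  by apply: le_trans; apply Asemi.
have geo m : ip (A (iter m E e)) (iter m E e) <= geometric (ip (A e) e) (1 - d) m.
  elim: m => [|m IHm]; first by rewrite /= expr0 mulr1.
  rewrite iterS (le_trans (contr _))//= exprS mulrCA ler_wpM2l//.
have h0 : geometric (ip (A e) e) (1 - d) @ \oo --> (0 : R).
  by apply: cvg_geometric; rewrite ger0_norm// ltrBlDr ltrDl.
apply: squeeze_cvgr (cvg_cst _) h0.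
by near=> m; rewrite geo andbT; apply Asemi.
Unshelve. all: by end_near.
Qed.

End Contraction.

End SemiSPD.

(** * Costs of decompositions through [Pi] *)

Section Method.
Variables (R : realType) (V W : vectType R).
Variables (ipV : {dot V for idfun}) (ipW : {dot W for idfun}).
Variables (A : 'End(V)) (Pi : 'Hom(W, V)) (Bbar : 'End(W)).
Hypothesis Asemi : semiSPD ipV A.
Hypothesis Pi_surj : limg Pi = fullv.
Hypothesis BbarSPD : SPD ipW Bbar.

Let Pit := adjoint ipW ipV Pi.
Let M : 'End(V) := (Pi \o Bbar \o Pit)%VF.

Lemma form_congr u v : ipV (M u) v = ipW (Bbar (Pit u)) (Pit v).
Proof. by rewrite !comp_lfunE (adjointP ipW). Qed.

(** Surjectivity of [Pi] makes [Pit] injective, so definiteness passes from [Bbar] to [M]. *)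
Lemma SPD_congr : SPD ipV M.
Proof.
case: (BbarSPD) => Bsym Bpos; split=> [u v|v v0].
  by rewrite form_congr Bsym dotC -form_congr dotC.
rewrite form_congr; apply: Bpos; apply: contra_neq v0 => Pitv0.
have /memv_imgP[w _ vE] : v \in limg Pi by rewrite Pi_surj memvf.
by apply: (dot_eq0 (ip := ipV)); rewrite {1}vE (adjointP ipW) Pitv0 linear0r.
Qed.

Lemma SPD_inv_CauchySchwarz g w :
  ipW g w ^+ 2 <= ipW (Bbar g) g * ipW (Bbar^-1%VF w) w.
Proof.
have [z ->] : exists z, w = Bbar z.
  by exists (Bbar^-1%VF w); rewrite lker0_lfunVK ?(SPD_lker0 BbarSPD).
rewrite lker0_lfunK ?(SPD_lker0 BbarSPD)// -!(proj1 BbarSPD).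
by rewrite semiSPD_CauchySchwarz//; apply: SPD_semiSPD.
Qed.

Let decomposition_cost v : \bar R :=
  ereal_inf [set ereal_inf
      [set (ipW (Bbar^-1%VF w) w)%:E | w in [set w | Pi w = v + phi]]
    | phi in [set phi | phi \in lker A]].

Lemma decomposition_cost_le (K : R) v : 0 < K ->
  (forall u, K * ipV (A u) u <= ipV (M (A u)) (A u)) ->
  v \in limg A -> seminorm ipV A v = 1 -> (decomposition_cost v <= K^-1%:E)%E.
Proof.
move=> K0 K_le vA /(seminorm_eq1 Asemi) v1.
have /memv_imgP[u _] : A v \in limg (A \o M \o A)%VF.
  by rewrite (limg_congr Asemi SPD_congr) memv_img ?memvf.
rewrite !(comp_lfunE A, comp_lfunE (A \o M)%VF) => AvE.
set X := ipV (M (A u)) (A u).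
(* [X] is the cost of [w = Bbar Pit A u], with kernel part [phi = M A u - v]. *)
apply: (@le_trans _ _ X%:E).
  apply: (@le_trans _ _ (ereal_inf [set (ipW (Bbar^-1%VF w) w)%:E |
      w in [set w | Pi w = v + (M (A u) - v)]])).
    apply: ereal_inf_lbound; exists (M (A u) - v) => //=.
    by rewrite memv_ker linearB /= AvE subrr.
  apply: ereal_inf_lbound; exists (Bbar (Pit (A u))) => /=.
    by rewrite addrC subrK !comp_lfunE.
  by rewrite lker0_lfunK ?(SPD_lker0 BbarSPD)// dotC -form_congr.
rewrite lee_fin.
have XE : X = ipV (A v) u by rewrite /X -(proj1 Asemi) -AvE.
(* Together with [K (Au, u) <= X] this yields [K X^2 <= X], hence [X <= 1/K]. *)
have : X ^+ 2 <= ipV (A u) u.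
  by rewrite XE (le_trans (semiSPD_CauchySchwarz _ _ Asemi))// v1 mul1r.
rewrite -(ler_pM2l K0) => /le_trans/(_ (K_le u)); rewrite -/X => KX.
have [X0|X0] := leP X 0; first by rewrite (le_trans X0)// invr_ge0 ltW.
by move: KX; rewrite expr2 mulrA -[leRHS]mul1r ler_pM2r// -ler_pdivlMl// mulr1.
Qed.

(** With [g = Pit (A u)], every admissible [w] has [(g, w) = (Au, v + phi) = 1], so Cauchy-Schwarz
    gives [1 <= (Bbar g, g) (Bbar^-1 w, w)]. Later [v] is the range component of [u], because the
    supremum only sees vectors of the range. *)
Lemma decomposition_cost_ge u v : A u = A v -> seminorm ipV A u = 1 ->
  0 < ipV (M (A u)) (A u) ->
  ((ipV (M (A u)) (A u))^-1%:E <= decomposition_cost v)%E.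
Proof.
move=> Auv /(seminorm_eq1 Asemi) u1 X0.
apply/le_ereal_inf_tmp => _ [phi /= phiA <-]; apply/le_ereal_inf_tmp => _ [w /= wE <-].
rewrite lee_fin -[_^-1]mulr1 ler_pdivrMl// form_congr.
apply: le_trans (SPD_inv_CauchySchwarz _ _).
have -> : ipW (Pit (A u)) w = 1; last by rewrite expr1n.
rewrite adjoint_dot wE linearDr /= Auv (proj1 Asemi v phi).
move: phiA; rewrite memv_ker => /eqP ->; rewrite linear0r addr0.
by rewrite -Auv (proj1 Asemi) -Auv dotC.
Qed.

Lemma sup_decomposition_cost (K : R) u0 : 0 < K -> seminorm ipV A u0 = 1 ->
  (forall u, K * ipV (A u) u <= ipV (M (A u)) (A u)) ->
  (forall k, (forall v, seminorm ipV A v = 1 -> k <= ipV (M (A v)) (A v)) ->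
    k <= K) ->
  ereal_sup [set decomposition_cost v |
    v in [set v | v \in limg A /\ seminorm ipV A v = 1]] = K^-1%:E.
Proof.
move=> K0 u01 K_le K_glb; set S := ereal_sup _.
have M_gt0 u : seminorm ipV A u = 1 -> 0 < ipV (M (A u)) (A u).
  by move=> /(seminorm_eq1 Asemi) u1; have := K_le u; rewrite u1 mulr1; apply: lt_le_trans.
have S_ge u : seminorm ipV A u = 1 -> ((ipV (M (A u)) (A u))^-1%:E <= S)%E.
  move=> u1; have AQ := symmetric_orthproj_limg u (proj1 Asemi).
  apply: le_trans (decomposition_cost_ge (esym AQ) u1 (M_gt0 u u1)) _.
  apply: ereal_sup_ubound; exists (orthproj ipV (limg A) u) => //=.
  split; first exact: orthproj_mem.
  move/(seminorm_eq1 Asemi): u1 => u1; apply/(seminorm_eq1 Asemi).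
  by rewrite AQ (proj1 Asemi) AQ dotC.
have S_le : (S <= K^-1%:E)%E.
  by apply: ge_ereal_sup => _ [v /= [vA v1] <-]; exact: decomposition_cost_le.
apply/eqP; rewrite eq_le S_le /=.
(* Once [S] is a real [s], its inverse is a lower bound of [(MAv, Av)] on the unit sphere, hence at
   most [K]. *)
case: S S_le S_ge => [s| |] // S_le S_ge; last by have := S_ge _ u01.
have s0 : 0 < s.
  have := S_ge _ u01; rewrite lee_fin; apply: lt_le_trans.
  by rewrite invr_gt0 M_gt0.
rewrite lee_fin -lef_pV2 ?posrE ?invr_gt0// invrK; apply: K_glb => v v1.
by rewrite -lef_pV2 ?posrE ?invr_gt0 ?M_gt0// invrK -lee_fin S_ge.
Qed.

End Method.

(** * The energy identity and the final assembly *)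

Lemma smoother_energy (R : realType) (V W : vectType R)
    (ipV : {dot V for idfun}) (ipW : {dot W for idfun})
    (A : 'End(V)) (Pi : 'Hom(W, V)) (Bt : 'End(W)) :
  let Pit := adjoint ipW ipV Pi in
  let Btt := adjoint ipW ipW Bt in
  let Bbar : 'End(W) := (Bt + Btt - (Btt \o (Pit \o A \o Pi) \o Bt)%VF)%R in
  let E : 'End(V) := (\1%VF - (Pi \o Bt \o Pit \o A)%VF)%R in
  symmetric_op ipV A -> forall v,
  ipV (A (E v)) (E v) =
    ipV (A v) v - ipV ((Pi \o Bbar \o Pit)%VF (A v)) (A v).
Proof.
move=> Pit Btt Bbar E Asym v.
set g := Pit (A v); set z := Pi (Bt g).
have -> : E v = v - z.
  by rewrite /z /g /E add_lfunE opp_lfunE id_lfunE !comp_lfunE.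
have -> : ipV ((Pi \o Bbar \o Pit)%VF (A v)) (A v) = ipW (Bbar g) g.
  by rewrite !comp_lfunE (adjointP ipW).
(* The two linear terms of [Bbar] give the cross terms of [(A(v - z), v - z)], and its last term
   gives [(Az, z)]. *)
have -> : ipW (Bbar g) g = ipV z (A v) + ipV (A v) z - ipV (A z) z.
  have -> : Bbar g = Bt g + Btt g - Btt (Pit (A z)).
    by rewrite /Bbar /z /g !add_lfunE opp_lfunE !comp_lfunE.
  rewrite linearBl /= linearDl /= !adjoint_dot.
  by congr (_ + _ - _); rewrite /g /z ?adjoint_dot ?(adjointP ipW).
have -> : A (v - z) = A v - A z by rewrite linearB.
rewrite linearBl /= !linearBr /= (Asym z v) (dotC _ z).
lra.
Qed.

Theorem theorem5p1 (R : realType) (V W : vectType R)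
    (ipV : {dot V for idfun}) (ipW : {dot W for idfun})
    (A : 'End(V)) (f : V) (Pi : 'Hom(W, V)) (Bt : 'End(W)) :
  let Pit := adjoint ipW ipV Pi in
  let Btt := adjoint ipW ipW Bt in
  let At : 'End(W) := (Pit \o A \o Pi)%VF in
  let B : 'End(V) := (Pi \o Bt \o Pit)%VF in
  let Bbar : 'End(W) := Bt + Btt - (Btt \o At \o Bt)%VF in
  semiSPD ipV A ->
  A != 0 ->
  f \in limg A ->
  limg Pi = fullv ->
  SPD ipW Bbar ->
  method_converges ipV A f (iterates A B f) /\
  ((opseminorm ipV A (\1%VF - (B \o A)%VF)%R) ^+ 2 =
   1 - (ereal_sup
         [set ereal_inf
           [set ereal_inf
             [set (ipW ((Bbar^-1)%VF w) w)%:E | w in [set w | Pi w = (v + phi)%R]]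
           | phi in [set phi | phi \in lker A]]
         | v in [set v | v \in limg A /\ seminorm ipV A v = 1%R]])^-1)%E.
Proof.
move=> Pit Btt At B Bbar Asemi A0 /memv_imgP[uf _ ->] Pi_surj BbarSPD.
set E : 'End(V) := (\1%VF - (B \o A)%VF)%R.
pose M : 'End(V) := (Pi \o Bbar \o Pit)%VF.
pose q v := ipV (M (A v)) (A v).
have MSPD : SPD ipV M := SPD_congr ipV Pi_surj BbarSPD.
have energy v : ipV (A (E v)) (E v) = ipV (A v) v - q v.
  exact: smoother_energy (proj1 Asemi) v.
have [d d0 d_le] := semiSPD_coercive Asemi MSPD.
(* Without a unit vector, normalization would force [A v = 0] for all [v], against [A != 0]. *)
have [u0 u01] : exists u0, seminorm ipV A u0 = 1.
  apply: contrapT => noU; move: A0; apply/negP; rewrite negbK.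
  apply/eqP/lfunP => v; rewrite lfunE /=; apply/eqP; apply: contraT => Av0.
  by have [c _ [c1 _]] := seminorm_normalize Asemi Av0; case: noU; exists (c^-1 *: v).
split.
  move=> u0' u Au.
  have [C C0 hC] := orthproj_bound Asemi.
  (* Since the data equal [A u], the error is propagated by [E = I - BA]. *)
  have iterE m : iterates A B (A uf) u0' m - u = iter m E (u0' - u).
    elim: m => // m IHm; rewrite /iterates /= -/(iterates A B (A uf) u0' m) -IHm.
    set x := iterates _ _ _ _ _; rewrite -Au /E add_lfunE opp_lfunE id_lfunE comp_lfunE.
    have -> : A (x - u) = - (A u - A x) by rewrite opprB linearB.
    by rewrite linearN opprK addrAC.
  have h0 : (fun m => C * ipV (A (iter m E (u0' - u))) (iter m E (u0' - u)))
      @ \oo --> (0 : R).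
    rewrite -(mulr0 C); apply: cvgM; first exact: cvg_cst.
    exact: (iterates_seminorm_cvg Asemi energy u01 d0 d_le).
  have h1 : (fun m => Num.sqrt (C * ipV (A (iter m E (u0' - u))) (iter m E (u0' - u))))
      @ \oo --> (0 : R).
    rewrite -(@sqrtr0 R).
    by apply: continuous_cvg => //; exact: sqrt_continuous.
  apply: squeeze_cvgr (cvg_cst _) h1.
  near=> m; rewrite sqrtr_ge0 /= -linearB /= iterE.
  rewrite -(ler_pXn2r (n := 2))// ?nnegrE ?sqrtr_ge0// [leRHS]sqr_sqrtr.
    exact: hC.
  by apply: mulr_ge0; [exact: ltW | apply Asemi].
(* The infimum of [Q] is the constant [K] of the lemmas above; the coercivity constant [d] keeps it
   positive. *)
pose Q : set R := [set q v | v in [set v | seminorm ipV A v = 1]].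
have Q_lb : lbound Q d.
  by move=> _ [v /= /(seminorm_eq1 Asemi) v1 <-]; have := d_le v; rewrite v1 mulr1.
have Q0 : Q !=set0 by exists (q u0); exists u0.
have K_glb k : (forall v, seminorm ipV A v = 1 -> k <= q v) -> k <= inf Q.
  by move=> k_le; apply: lb_le_inf => // _ [v /= v1 <-]; exact: k_le.
have K_lb v : seminorm ipV A v = 1 -> inf Q <= q v.
  by move=> v1; apply: ge_inf; [exists d | exists v].
have K0 : 0 < inf Q by apply: lt_le_trans d0 _; exact: lb_le_inf.
(* By homogeneity the bound extends from the unit sphere to all [u]; both sides vanish when
   [A u = 0]. *)
have K_le u : inf Q * ipV (A u) u <= q u.
  have [Au0|Au0] := eqVneq (A u) 0; first by rewrite /q Au0 !(linear0l, linear0r).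
  have [c c0 [c1 <-]] := seminorm_normalize Asemi Au0.
  have := K_lb _ c1; rewrite /q [A (_ *: _)]lfun_scaler form_scale exprVn.
  by rewrite mulrC ler_pdivlMr ?exprn_gt0.
rewrite (sqr_opseminorm Asemi energy u01 K_lb K_glb).
rewrite (sup_decomposition_cost Asemi Pi_surj BbarSPD K0 u01 K_le K_glb).
(* The extended inverse takes its finite branch because [inf Q] is nonzero. *)
by rewrite inver invr_eq0 gt_eqF// invrK.
Unshelve. all: by end_near.
Qed.
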